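(* Let $f:\mathbb{R}^p\to\mathbb{R}$ be twice continuously differentiable and let $\rho\ge 0$. Suppose there exist sequences $\{x^n\}\subset\mathbb{R}^p$ and $\{\kappa_n\}\subset\mathbb{R}_{\ge 0}$ such that 1. $\kappa_n\to\infty$ as $n\to\infty$; 2. $\liminf_{n}\kappa_n\Vert\nabla f(x^n)\Vert_2^{\rho}=\infty$; and 3. $\Vert\nabla^2 f(x^n)\Vert_2\ge\kappa_n\Vert\nabla f(x^n)\Vert_2^{\rho}$ for all $n$. Then $\nabla f$ is not $\rho$-order Lipschitz continuous for any $C_0,C_1\ge 0$ (that is, $\nabla f$ is not $\rho$-order Lipschitz continuous).
   Context: $\Vert\cdot\Vert_2$ is the Euclidean norm for vectors and the induced operator (spectral) norm for matrices. Convention: $0^0=1$. A continuous function $D:\mathbb{R}^p\to\mathbb{R}^p$ is $\rho$-order Lipschitz continuous (with constants $C_0,C_1\ge 0$) if there exist constants $C_0,C_1\ge 0$ and, for every $x\in\mathbb{R}^p$, there exists an open ball $B_x$ around $x$ (centered at $x$, of positive radius), such that $$\Vert D(x_1)-D(x_2)\Vert_2\le \left(C_0+C_1\Vert D(x)\Vert_2^{\rho}\right)\Vert x_1-x_2\Vert_2\quad\text{for all }x_1,x_2\in B_x.$$ The constants $C_0,C_1$ do not depend on $x$. *)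

(* Defs.v *)
From HB Require Import structures.
From mathcomp Require Import all_boot all_order all_algebra.
From mathcomp Require Import all_classical all_reals all_analysis.

Set Implicit Arguments.
Unset Strict Implicit.
Unset Printing Implicit Defensive.

Import Order.TTheory GRing.Theory Num.Theory.
Import numFieldNormedType.Exports.

Local Open Scope classical_set_scope.
Local Open Scope ring_scope.

(* Points of R^p are row vectors, as in the library's [jacobian]. The library  *)
(* norm [`|x|] on matrices is the max norm; it induces the same topology, hence *)
(* the same notions of continuity and differentiability, as the Euclidean norm *)
(* below, but it is never used as a norm here.                                 *)

Definition enorm (R : realType) (p : nat) (x : 'rV[R]_p) : R :=
  Num.sqrt (\sum_(i < p) x 0 i ^+ 2).

(* Operator norm induced by [enorm]; matrices act on row vectors on the right. *)
Definition opnorm (R : realType) (m n : nat) (A : 'M[R]_(m, n)) : R :=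
  sup [set enorm (u *m A) | u in [set u : 'rV[R]_m | enorm u <= 1]].

Definition gradient (R : realType) (p : nat) (f : 'rV[R]_p -> R)
    (x : 'rV[R]_p) : 'rV[R]_p :=
  \row_(i < p) 'D_(delta_mx 0 i) f x.

Definition hessian (R : realType) (p : nat) (f : 'rV[R]_p -> R)
    (x : 'rV[R]_p) : 'M[R]_p :=
  'J (gradient f) x.

Definition twice_continuously_differentiable (R : realType) (p : nat)
    (f : 'rV[R]_p -> R) : Prop :=
  [/\ forall x, differentiable f x,
      forall x, differentiable (gradient f) x
    & continuous (hessian f)].

(* The convention 0^0 = 1 is the library's: [powRr0 : a `^ 0 = 1] for every a.   *)
Definition order_lipschitz (R : realType) (p : nat) (rho : R)
    (D : 'rV[R]_p -> 'rV[R]_p) : Prop :=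
  continuous D /\
  exists C0 C1 : R, [/\ 0 <= C0, 0 <= C1 &
    forall x : 'rV[R]_p, exists2 r : R, 0 < r &
      forall x1 x2 : 'rV[R]_p, enorm (x1 - x) < r -> enorm (x2 - x) < r ->
        enorm (D x1 - D x2) <=
          (C0 + C1 * enorm (D x) `^ rho) * enorm (x1 - x2)].

(* Main.v *)
(* A local Lipschitz bound passes to the limit in difference quotients, so it
   bounds the operator norm of the derivative at the centre of the ball:
   ||H(x_n)|| <= C0 + C1 ||grad f(x_n)||^rho. Together with hypothesis 3, once
   kappa_n >= 2 C1, this yields kappa_n ||grad f(x_n)||^rho <= 2 C0, so the
   limit inferior is finite. *)
Require Import Defs.
From HB Require Import structures.
From mathcomp Require Import all_boot all_order all_algebra.
From mathcomp Require Import all_classical all_reals all_analysis.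
From mathcomp Require Import lra.

Set Implicit Arguments.
Unset Strict Implicit.
Unset Printing Implicit Defensive.

Import Order.TTheory GRing.Theory Num.Theory.
Import numFieldNormedType.Exports.

Local Open Scope classical_set_scope.
Local Open Scope ring_scope.

Lemma enorm0 (R : realType) (p : nat) : enorm (0 : 'rV[R]_p) = 0.
Proof. by rewrite /enorm big1 ?sqrtr0// => i _; rewrite mxE expr0n. Qed.

Lemma enormZ (R : realType) (p : nat) (a : R) (u : 'rV[R]_p) :
  enorm (a *: u) = `|a| * enorm u.
Proof.
rewrite /enorm -sqrtr_sqr -sqrtrM ?sqr_ge0// mulr_sumr.
by congr Num.sqrt; apply: eq_bigr => i _; rewrite mxE exprMn.
Qed.

Lemma enorm_continuous (R : realType) (p : nat) :
  continuous (@enorm R p).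
Proof.
move=> u; apply: (@continuous_comp _ _ _
  (fun v : 'rV[R]_p => \sum_(i < p) v 0 i ^+ 2) Num.sqrt);
  last exact: sqrt_continuous.
apply: (@cvg_big _ _ _ _ _ (@add_continuous R^o) _ (nbhs u)) => i _.
by apply: (@continuous_comp _ _ _ (fun v : 'rV[R]_p => v 0 i)
  (fun a : R => a ^+ 2)); [exact: coord_continuous|exact: exprn_continuous].
Qed.

Lemma opnorm_le (R : realType) (m n : nat) (A : 'M[R]_(m, n)) (L : R) :
  (forall u : 'rV[R]_m, enorm u <= 1 -> enorm (u *m A) <= L) -> opnorm A <= L.
Proof.
move=> AL; apply: ge_sup; last by move=> _ [u /AL + <-].
(* [ge_sup] asks for a nonempty set: the zero vector lies in the unit ball. *)
by exists (enorm (0 *m A)), 0 => //=; rewrite enorm0.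
Qed.

Lemma opnorm_jacobian_le (R : realType) (p : nat) (D : 'rV[R]_p -> 'rV[R]_p)
    (x : 'rV[R]_p) (L r : R) :
  differentiable D x -> 0 <= L -> 0 < r ->
  (forall y, enorm (y - x) < r -> enorm (D y - D x) <= L * enorm (y - x)) ->
  opnorm ('J D x) <= L.
Proof.
move=> dD L0 r0 Dlip; apply: opnorm_le => u u1.
(* [u *m 'J D x] is the derivative of [D] at [x] along [u], so bounding its difference quotients
   near [h = 0] is enough. *)
rewrite -deriveEjacobian//.
have /cvg_comp/(_ (@enorm_continuous R p _)) dq : (fun h : R =>
    h^-1 *: ((D \o shift x) (h *: u) - D x)) @ 0^' --> 'D_u D x.
  exact: diff_derivable.
apply: (cvgr_to_le dq).
near=> h => /=.
have h0 : 0 < `|h| by rewrite normr_gt0; near: h; exact: nbhs_dnbhs_neq.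
have hr : `|h| < r by near: h; exact: dnbhs0_lt.
(* As [enorm u <= 1], the condition [|h| < r] keeps [h *: u + x] in the ball. *)
have huh : enorm (h *: u) <= `|h| by rewrite enormZ ler_piMr.
rewrite enormZ normfV mulrC ler_pdivrMr//.
have := Dlip (h *: u + x); rewrite addrK => /(_ (le_lt_trans huh hr)).
by move=> /le_trans; apply; rewrite ler_wpM2l.
Unshelve. all: by end_near.
Qed.

(** The limit inferior is the limit of the tail infima, and each tail infimum is at most the first
    term of its tail. *)
Lemma limn_einf_le (R : realType) (u : (\bar R)^nat) (a : \bar R) :
  (\forall n \near \oo, u n <= a)%E -> (limn_einf u <= a)%E.
Proof.
move=> ua; rewrite limn_einf_lim; apply: lime_le; first exact: is_cvg_einfs.
apply: filterS ua => n; apply: le_trans.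
by apply: ereal_inf_lbound; exists n => /=.
Qed.

Theorem lemma5 (R : realType) (p : nat) (f : 'rV[R]_p -> R) (rho : R)
    (x : nat -> 'rV[R]_p) (kappa : nat -> R)
    (f_C2 : twice_continuously_differentiable f)
    (rho_ge0 : 0 <= rho)
    (kappa_ge0 : forall n, 0 <= kappa n)
    (kappa_infty : kappa n @[n --> \oo] --> +oo)
    (liminf_infty :
      limn_einf (fun n => (kappa n * enorm (gradient f (x n)) `^ rho)%:E) = +oo%E)
    (hessian_ge : forall n,
      kappa n * enorm (gradient f (x n)) `^ rho <= opnorm (hessian f (x n))) :
  ~ order_lipschitz rho (gradient f).
Proof.
case: f_C2 => _ df _ [_ [C0 [C1 [C0_ge0 C1_ge0 lip]]]].
suff : (limn_einf (fun n => (kappa n * enorm (gradient f (x n)) `^ rho)%:E)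
    <= (2 * C0)%:E)%E by rewrite liminf_infty leye_eq.
apply: limn_einf_le.
(* Beyond the threshold [2 * C1], the term [C1 * g] is at most half of [kappa n * g] and can be
   absorbed. *)
move/cvgryPge: kappa_infty => /(_ (2 * C1)); apply: filterS => n kappa_ge.
rewrite lee_fin; set g := enorm _ `^ rho.
have g0 : 0 <= g by exact: powR_ge0.
have : kappa n * g <= C0 + C1 * g.
  apply: le_trans (hessian_ge n) _; have [r r0 xr] := lip (x n).
  apply: (opnorm_jacobian_le _ _ r0) => //.
    by rewrite addr_ge0// mulr_ge0.
  (* The second point of the Lipschitz bound is the centre [x n] itself. *)
  by move=> y yr; apply: xr => //; rewrite subrr enorm0.
have : 2 * C1 * g <= kappa n * g by rewrite ler_wpM2r.
(* Doubling the first bound gives [2 * (kappa n * g) <= 2 * C0 + 2 * C1 * g <= 2 * C0 + kappa n *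
   g]. *)
by lra.
Qed.
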